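(* Let $\Delta$ be a simplicial complex on $[m]$, and let $L\subset V$ be a linear subspace containing the constant function $1$ such that the log-affine model $\mathcal{M}(L)$ is a hierarchical subspace model (HSM) of $H_\Delta$. Let $\mathcal{C}$ be the set of maximal compact components of $\mathrm{red}\,\Delta$ and $\mathcal{S}$ the associated multiset of dividers. Then the maximum likelihood estimator (MLE) $\hat p(\boldsymbol{i})$ of the cell probabilities under $\mathcal{M}(L)$, based on a contingency table $\boldsymbol{x}=\{x(\boldsymbol{i})\}$ with total frequency $n$, satisfies $$\hat p(\boldsymbol{i})=\frac{\prod_{C\in\mathcal{C}}\hat p(\boldsymbol{i}_C)}{\prod_{S\in\mathcal{S}}\hat p(\boldsymbol{i}_S)}=\frac{\prod_{C\in\mathcal{C}}\hat p(\boldsymbol{i}_C)}{\prod_{S\in\mathcal{S}}x(\boldsymbol{i}_S)/n},\qquad \boldsymbol{i}\in\mathcal{I},$$ where, for each $C\in\mathcal{C}$, $\hat p(\boldsymbol{i}_C)$ coincides with the MLE of the model associated with the linear space $L\cap F_C$, which is computed only on the marginal table $x(\boldsymbol{i}_C)$.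
   Context: **Tables and log-affine models.** $[J]=\{1,\dots,J\}$. Fix $I_1,\dots,I_m\ge 2$, $\mathcal{I}=[I_1]\times\cdots\times[I_m]$, and let $V$ be the real vector space of functions $\mathcal{I}\to\mathbb{R}$. For $D\subset[m]$: $\boldsymbol{i}_D=(i_j)_{j\in D}$, $\mathcal{I}_D=\prod_{j\in D}[I_j]$, and $F_D\subset V$ is the subspace of functions depending only on $\boldsymbol{i}_D$ (identified with the functions on $\mathcal{I}_D$). For a probability function $p$ on $\mathcal{I}$ and a contingency table $\boldsymbol{x}=\{x(\boldsymbol{i})\}_{\boldsymbol{i}\in\mathcal{I}}$ of nonnegative integer frequencies, $p(\boldsymbol{i}_D)$ and $x(\boldsymbol{i}_D)$ denote the marginals obtained by summing over $\boldsymbol{i}_{[m]\setminus D}$, and $n=\sum_{\boldsymbol{i}}x(\boldsymbol{i})$. For a linear subspace $L\subset V$ containing the constant $1$, the log-affine model $\mathcal{M}(L)$ is the set of probability functions $p$ with $\log p\in L$. The MLE $\hat p$ is the maximizer of $\sum_{\boldsymbol{i}}x(\boldsymbol{i})\log p(\boldsymbol{i})$ over $p\in\mathcal{M}(L)$; the table is assumed to be such that it exists. $\hat p(\boldsymbol{i}_D)$ is the MLE of $p(\boldsymbol{i}_D)$, i.e. the $D$-marginal of $\hat p$. The model associated with $L\cap F_C$ is the log-affine model on $\mathcal{I}_C$, with observed table $\{x(\boldsymbol{i}_C)\}$. **Saturation and conformality.** $D\subset[m]$ is saturated in $L$ if $F_D\subset L$. $L$ is conformal to subspaces $W_1,\dots,W_K$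 if $L=(L\cap W_1)+\cdots+(L\cap W_K)$. **Hierarchical models and hypergraphs.** For a simplicial complex $\Delta$ on $[m]$, $\mathrm{red}\,\Delta$ is the set of its facets, regarded as a hypergraph, and $H_\Delta=\sum_{D\in\mathrm{red}\,\Delta}F_D$. Two vertices are adjacent if they lie in a common hyperedge; a hypergraph is connected if any two vertices are joined by a path of adjacent vertices. For $E\subset [m]$, the subhypergraph induced by $E$ consists of the maximal sets among $D\cap E$, $D\in\mathrm{red}\,\Delta$. A partial edge is a subset of a hyperedge. A partial edge $S$ is a (partial edge) separator if the subhypergraph induced by $[m]\setminus S$ is disconnected; then there is a decomposition $\{A,B,S\}$: a partition of $[m]$ with $A,B$ non-empty and no vertex of $A$ adjacent to a vertex of $B$. $S$ separates $u$ and $v$ if there is such a decomposition with $u\in A$, $v\in B$. A partial edge separator $S$ is a divider if there are two vertices $u,v$ separated by $S$ but by no proper subset of $S$. Vertices not separated by any partial edge are called tightly connected; $C\subset[m]$ is a compact component if any two of its vertices are tightly connected. $\mathcal{C}$ is the set of maximal compact components. These can be ordered as $C_1,\dots,C_{|\mathcal{C}|}$ so that $S_k=(C_1\cup\cdots\cup C_{k-1})\cap C_k$, $k=2,\dots,|\mathcal{C}|$, are dividers; $\mathcal{S}=\{S_2,\dots,S_{|\mathcal{C}|}\}$ is the resulting multiset. **HSM.** $\mathcal{M}(L)$ is a hierarchical subspace model (HSM) of $H_\Delta$ if (1) each divider $S\in\mathcal{S}$ of $\mathrm{red}\,\Delta$ is saturated in $L$, and (2) $L$ is conformal to $\{F_C: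 C\in\mathcal{C}\}$.
   Formalization: The multiset of dividers is taken from an ordering that also has the running intersection property (each S_k lies in some earlier C_j); requiring only that every S_k be a divider does not determine the multiset, and the formula can then fail. Also n > 0. *)

(* Defs.v *)
From HB Require Import structures.
From mathcomp Require Import all_boot all_order all_algebra.
From mathcomp Require Import reals exp.

Set Implicit Arguments.
Unset Strict Implicit.
Unset Printing Implicit Defensive.

Import Order.TTheory GRing.Theory Num.Theory.
Local Open Scope ring_scope.

(** A hypergraph on the vertex set ['I_m] is given by its set of hyperedges.
    The variable with index [j] has the levels ['I_(lev j)]. *)

(** Not every vertex is required to be a face; an uncovered vertex is an
    isolated vertex of the hypergraph of facets. *)
Definition simplicial_complex (m : nat) (Delta : {set {set 'I_m}}) : Prop :=
  set0 \in Delta /\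
  forall D E : {set 'I_m}, D \in Delta -> E \subset D -> E \in Delta.

Definition maximal_sets (m : nat) (H : {set {set 'I_m}}) : {set {set 'I_m}} :=
  [set D | maxset (fun E => E \in H) D].

Definition red (m : nat) (Delta : {set {set 'I_m}}) : {set {set 'I_m}} :=
  maximal_sets Delta.

Definition adjacent (m : nat) (H : {set {set 'I_m}}) (u v : 'I_m) : bool :=
  [exists D in H, (u \in D) && (v \in D)].

(** The vertex set of the induced subhypergraph is all of [E], including the
    vertices that no hyperedge covers. *)
Definition induced (m : nat) (H : {set {set 'I_m}}) (E : {set 'I_m}) :
    {set {set 'I_m}} :=
  maximal_sets [set D :&: E | D in H].

(** [E] is the vertex set and [H] the set of hyperedges. *)
Definition hconnected (m : nat) (E : {set 'I_m}) (H : {set {set 'I_m}}) : bool :=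
  [forall u in E, forall v in E, connect (adjacent H) u v].

Definition partial_edge (m : nat) (H : {set {set 'I_m}}) (S : {set 'I_m}) : bool :=
  [exists D in H, S \subset D].

Definition separator (m : nat) (H : {set {set 'I_m}}) (S : {set 'I_m}) : bool :=
  partial_edge H S && ~~ hconnected (~: S) (induced H (~: S)).

(** [S] may be empty, unlike the blocks of a [partition]. *)
Definition decomposition (m : nat) (H : {set {set 'I_m}})
    (A B S : {set 'I_m}) : bool :=
  [&& A :|: B :|: S == setT,
      [disjoint A & B], [disjoint A & S], [disjoint B & S],
      A != set0, B != set0 &
      [forall u in A, forall v in B, ~~ adjacent H u v]].

Definition separates (m : nat) (H : {set {set 'I_m}}) (S : {set 'I_m})
    (u v : 'I_m) : bool :=
  separator H S &&
  [exists A : {set 'I_m}, exists B : {set 'I_m},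
     [&& decomposition H A B S, u \in A & v \in B]].

Definition divider (m : nat) (H : {set {set 'I_m}}) (S : {set 'I_m}) : bool :=
  separator H S &&
  [exists u, exists v, separates H S u v &&
     [forall S' : {set 'I_m}, (S' \proper S) ==> ~~ separates H S' u v]].

Definition tightly_connected (m : nat) (H : {set {set 'I_m}}) (u v : 'I_m) : bool :=
  [forall S : {set 'I_m}, partial_edge H S ==> ~~ separates H S u v].

Definition compact_component (m : nat) (H : {set {set 'I_m}}) (C : {set 'I_m}) : bool :=
  [forall u in C, forall v in C, tightly_connected H u v].

Definition max_compact_components (m : nat) (H : {set {set 'I_m}}) :
    {set {set 'I_m}} :=
  [set C | maxset (compact_component H) C].

(** Positions are counted from 0: [sep_at Cs k] is the intersection of the
    entry in position [k] with the union of all the earlier ones. *)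
Definition sep_at (m : nat) (Cs : seq {set 'I_m}) (k : nat) : {set 'I_m} :=
  (\bigcup_(C <- take k Cs) C) :&: nth set0 Cs k.

(** A sequence, not a set: multiplicities matter in the product formula. *)
Definition divider_seq (m : nat) (Cs : seq {set 'I_m}) : seq {set 'I_m} :=
  [seq sep_at Cs k | k <- iota 1 (size Cs).-1].

(** The last condition is the running intersection property.  It is not
    implied by the others: for the facets
      {s,a,x}, {s,b,y}, {s,a,b,c}, {s,a,b,w}, {s,z},
    listed in this order, every separator is a divider, but one gets the
    multiset {s}, {s,a,b}, {s,a,b}, {s} in place of the divider multiset
    {s}, {s,a}, {s,b}, {s,a,b} of the hypergraph. *)
Definition perfect_ordering (m : nat) (H : {set {set 'I_m}})
    (Cs : seq {set 'I_m}) : Prop :=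
  [/\ uniq Cs,
      Cs =i max_compact_components H,
      forall S, S \in divider_seq Cs -> divider H S &
      forall k, (0 < k < size Cs)%N ->
        exists2 C, C \in take k Cs & sep_at Cs k \subset C].

Definition cell (m : nat) (lev : 'I_m -> nat) : finType :=
  {dffun forall j : 'I_m, 'I_(lev j)}.

Definition mcell (m : nat) (lev : 'I_m -> nat) (D : {set 'I_m}) : finType :=
  {dffun forall j : {j : 'I_m | j \in D}, 'I_(lev (val j))}.

Definition restr (m : nat) (lev : 'I_m -> nat) (D : {set 'I_m})
    (i : cell lev) : mcell lev D :=
  [ffun j : {j : 'I_m | j \in D} => i (val j)].

Definition marginal (A : nmodType) (m : nat) (lev : 'I_m -> nat)
    (D : {set 'I_m}) (f : {ffun cell lev -> A}) : {ffun mcell lev D -> A} :=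
  [ffun y => \sum_(i : cell lev | restr D i == y) f i].

(** [R^o] is [R] seen as a vector space over itself. *)
Definition fspace (R : realType) (T : finType) : vectType R := {ffun T -> R^o}.

Definition pullback (R : realType) (m : nat) (lev : 'I_m -> nat)
    (D : {set 'I_m}) (g : fspace R (mcell lev D)) : fspace R (cell lev) :=
  [ffun i => g (restr D i)].

Lemma pullback_is_linear (R : realType) (m : nat) (lev : 'I_m -> nat)
  (D : {set 'I_m}) : linear (@pullback R m lev D).
Proof. by move=> a f g; apply/ffunP=> i; rewrite !ffunE. Qed.

HB.instance Definition _ (R : realType) (m : nat) (lev : 'I_m -> nat)
    (D : {set 'I_m}) :=
  GRing.isLinear.Build R (fspace R (mcell lev D)) (fspace R (cell lev)) _
    (@pullback R m lev D) (@pullback_is_linear R m lev D).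

(** The functions depending only on the coordinates in [D]
    (see [Fsub_P] below). *)
Definition Fsub (R : realType) (m : nat) (lev : 'I_m -> nat) (D : {set 'I_m}) :
    {vspace fspace R (cell lev)} :=
  limg (linfun (@pullback R m lev D)).

Lemma Fsub_P (R : realType) (m : nat) (lev : 'I_m -> nat) (D : {set 'I_m})
    (f : fspace R (cell lev)) :
  f \in Fsub R lev D <->
  forall i i' : cell lev, (forall j, j \in D -> i j = i' j) -> f i = f i'.
Proof.
split=> [/memv_imgP [g _ ->] i i' eqi | fD].
  rewrite lfunE /= !ffunE; congr (g _); apply/ffunP=> j.
  by rewrite !ffunE; apply: eqi; apply: (valP j).
pose g : fspace R (mcell lev D) :=
  [ffun y => if [pick i : cell lev | restr D i == y] is Some i then f i else 0].
suff -> : f = linfun (@pullback R m lev D) g by apply/memv_img/memvf.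
rewrite lfunE /=; apply/ffunP=> i; rewrite !ffunE.
case: pickP => [i' /eqP eqi' | /(_ i)]; last by rewrite eqxx.
apply: fD => j jD.
by move/ffunP: eqi' => /(_ (exist _ j jD)); rewrite !ffunE.
Qed.

(** The space [L :&: Fsub C], identified with a space of functions on
    the marginal cells. *)
Definition marginal_space (R : realType) (m : nat) (lev : 'I_m -> nat)
    (L : {vspace fspace R (cell lev)}) (C : {set 'I_m}) :
    {vspace fspace R (mcell lev C)} :=
  (linfun (@pullback R m lev C) @^-1: (L :&: Fsub R lev C))%VS.

(** Positivity is explicit because [ln] is total, with [ln 0 = 0]. *)
Definition log_affine (R : realType) (T : finType) (L : {vspace fspace R T})
    (p : {ffun T -> R}) : Prop :=
  [/\ forall t, 0 < p t, \sum_t p t = 1 &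
      ([ffun t => ln (p t)] : fspace R T) \in L].

Definition loglik (R : realType) (T : finType) (x : {ffun T -> nat})
    (p : {ffun T -> R}) : R :=
  \sum_t (x t)%:R * ln (p t).

Definition is_MLE (R : realType) (T : finType) (L : {vspace fspace R T})
    (x : {ffun T -> nat}) (p : {ffun T -> R}) : Prop :=
  log_affine L p /\
  forall q : {ffun T -> R}, log_affine L q -> loglik x q <= loglik x p.

Definition saturated (R : realType) (m : nat) (lev : 'I_m -> nat)
    (L : {vspace fspace R (cell lev)}) (D : {set 'I_m}) : Prop :=
  (Fsub R lev D <= L)%VS.

Definition conformal (R : realType) (V : vectType R) (K : finType)
    (L : {vspace V}) (P : {pred K}) (W : K -> {vspace V}) : Prop :=
  L = (\sum_(k in P) (L :&: W k))%VS.

Definition HSM (R : realType) (m : nat) (lev : 'I_m -> nat)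
    (Delta : {set {set 'I_m}}) (Cs : seq {set 'I_m})
    (L : {vspace fspace R (cell lev)}) : Prop :=
  (forall S, S \in divider_seq Cs -> saturated L S) /\
  conformal L (mem (max_compact_components (red Delta))) (Fsub R lev).

(* Main.v *)
Require Import Defs.
From HB Require Import structures.
From mathcomp Require Import all_boot all_order all_algebra.
From mathcomp Require Import reals sequences exp.
From mathcomp Require Import ring lra.

Set Implicit Arguments.
Unset Strict Implicit.
Unset Printing Implicit Defensive.

Import Order.TTheory GRing.Theory Num.Theory.
Local Open Scope ring_scope.

(** Perturbing the MLE [p] by [exp (s f)] for [f] in [L] shows that it is the
    solution of the score equations [\sum x f = n \sum p f]; Gibbs' inequality
    shows that conversely a solution in the model is the unique MLE.  If
    [p(i_(A u C)) = g(i_A) h(i_C)], then summation gives [p(i_A) = g(i_A) h'(i_S)]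
    and [p(i_C) = h(i_C) g'(i_S)] with [S = A n C], and
    [p(i_(A u C)) p(i_S) = p(i_A) p(i_C)].  Peeling off the components one by one,
    from the last to the first, yields the product formula.  As [S] is saturated,
    [ln h'] and [ln g'] lie in [L]: hence the conformal form of [ln p] passes to
    the marginal on [A] and [ln p(i_C)] lies in [L], so that the marginal is a
    solution in the marginal model, where the score equations are inherited.  For
    saturated [S] they also say that [p(i_S) = x(i_S) / n]. *)

(** * Score equations and Gibbs' inequality on a finite set *)

(** From [1 - y <= expR (- y)] one gets [expR y * (1 - y) <= 1], while the quadratic times [1 - y]
    equals [1 + y ^+ 2 * (1 - 2 * y)], which is at least 1 here. *)
Lemma expR_le_quadratic (R : realType) (y : R) :
  `|y| <= 2^-1 -> expR y <= 1 + y + 2 * y ^+ 2.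
Proof.
rewrite ler_norml => /andP[y_ge y_le].
have E := expR_ge1Dx (- y); have e0 := expR_gt0 y.
have {}E : expR y * (1 - y) <= 1.
  by rewrite -[leRHS](expRxMexpNx_1 y) ler_pM2l.
have Q : 1 <= (1 + y + 2 * y ^+ 2) * (1 - y) by nra.
rewrite -(@ler_pM2r _ (1 - y)); last lra.
exact: le_trans E Q.
Qed.

Lemma ln_le_subr1 (R : realType) (y : R) : 0 < y -> ln y <= y - 1.
Proof.
move=> y0; have := expR_ge1Dx (ln y).
by rewrite lnK ?posrE // addrC -lerBrDr.
Qed.

Lemma ln_eq_subr1 (R : realType) (y : R) : 0 < y -> ln y = y - 1 -> y = 1.
Proof.
move=> y0 E; case: (eqVneq (ln y) 0) => [l0|/expR_gt1Dx]; first by lra.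
by rewrite lnK ?posrE // E; lra.
Qed.

(** The likelihood equations of an exponential family: observed and fitted sufficient statistics
    agree. Membership of [p] in the model is kept separate. *)
Definition score_equations (R : realType) (T : finType)
    (L : {vspace fspace R T}) (x : {ffun T -> nat}) (p : {ffun T -> R}) : Prop :=
  forall f : fspace R T, f \in L ->
    \sum_t (x t)%:R * f t = (\sum_t x t)%:R * \sum_t p t * f t.

(** This replaces differentiation at 0. For nonzero [a], testing at [t = e * a] with [e] small and
    positive gives [1 <= e * b], a contradiction once [e * |b| < 1]. *)
Lemma small_linear_le_quadratic (R : realFieldType) (a b d : R) :
  0 < d -> (forall t, `|t| <= d -> t * a <= b * t ^+ 2) -> a = 0.
Proof.
move=> d0 H; apply/eqP/negP => /negP a0.
have a2 : 0 < a ^+ 2 by rewrite exprn_even_gt0.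
pose c := `|a| + `|b| + 1.
have c0 : 0 < c by rewrite /c; have := normr_ge0 a; have := normr_ge0 b; lra.
(* As [c] exceeds both [|a|] and [|b|], this choice ensures [e * |a| <= d] and [e * |b| < 1] at
   once. *)
pose e := d / (c * (1 + d)).
have d1 : 0 < 1 + d by lra.
have e0 : 0 < e by rewrite /e divr_gt0 ?mulr_gt0.
have eb : e * `|b| < 1.
  rewrite /e mulrAC ltr_pdivrMr ?mul1r; last exact: mulr_gt0.
  rewrite /c; have := normr_ge0 a; have := normr_ge0 b; nra.
have := H (e * a); rewrite normrM (gtr0_norm e0).
have -> : e * `|a| <= d.
  rewrite /e mulrAC ler_pdivrMr; last exact: mulr_gt0.
  rewrite /c; have := normr_ge0 a; have := normr_ge0 b; nra.
move=> /(_ isT).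
have -> : b * (e * a) ^+ 2 = (e * a ^+ 2) * (e * b) by ring.
have -> : e * a * a = (e * a ^+ 2) * 1 by ring.
rewrite (ler_pM2l (mulr_gt0 e0 a2)) => H1.
have : e * b <= e * `|b| by rewrite ler_pM2l // ler_norm.
lra.
Qed.

Lemma const_memv (R : realType) (T : finType) (L : {vspace fspace R T}) (c : R) :
  ([ffun=> 1] : fspace R T) \in L -> ([ffun=> c] : fspace R T) \in L.
Proof.
move=> L1; suff -> : ([ffun=> c] : fspace R T) = c *: ([ffun=> 1] : fspace R T).
  exact: memvZ.
by apply/ffunP=> t; rewrite !ffunE; rewrite /GRing.scale /= mulr1.
Qed.

(** Centring [f0] under [p] removes the first-order term of the normalizing constant [Z] of the
    perturbed function, so [Z <= 1 + O(s ^+ 2)]. Maximality of [p] then bounds [s * \sum x f] by a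
    multiple of [s ^+ 2] for small [s] of either sign. *)
Lemma MLE_score (R : realType) (T : finType) (L : {vspace fspace R T})
    (x : {ffun T -> nat}) (p : {ffun T -> R}) :
  ([ffun=> 1] : fspace R T) \in L ->
  is_MLE L x p -> score_equations L x p.
Proof.
move=> L1 [[p0 p1 pL] pmax] f0 f0L.
set n : R := (_)%:R.
have nE : n = \sum_t (x t)%:R by rewrite /n natr_sum.
have n0 : 0 <= n by rewrite ler0n.
set mu := \sum_t p t * f0 t.
pose f : {ffun T -> R} := [ffun t => f0 t - mu].
have fL : (f : fspace R T) \in L.
  have -> : (f : fspace R T) = f0 - ([ffun=> mu] : fspace R T).
    by apply/ffunP=> t; rewrite !ffunE.
  by rewrite memvB // const_memv.
have pf0 : \sum_t p t * f t = 0.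
  under eq_bigr do rewrite ffunE mulrBr.
  by rewrite sumrB -mulr_suml p1 mul1r subrr.
suff E : \sum_t (x t)%:R * f t = 0.
  apply/eqP; rewrite -subr_eq0; apply/eqP; rewrite -[RHS]E.
  under [RHS]eq_bigr do rewrite ffunE mulrBr.
  by rewrite sumrB -mulr_suml nE.
pose M := \sum_t `|f t|.
have M0 : 0 <= M by apply: sumr_ge0.
have fM t : `|f t| <= M.
  by rewrite /M (bigD1 t) //= lerDl; apply: sumr_ge0.
(* The radius ensures [|s * f t| <= 1/2], the range of [expR_le_quadratic]; the summand 1 keeps it
   meaningful when [M = 0]. *)
apply: (@small_linear_le_quadratic _ _ (n * (2 * \sum_t p t * f t ^+ 2)) (2 * (M + 1))^-1).
  by rewrite invr_gt0; lra.
move=> s; rewrite invfM => hs.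
have sf t : `|s * f t| <= 2^-1.
  rewrite normrM; apply: (le_trans (ler_wpM2l _ (fM t))) => //.
  apply: (le_trans (ler_wpM2r M0 hs)).
  rewrite -mulrA -[leRHS]mulr1 ler_pM2l ?invr_gt0 //.
  by rewrite mulrC ler_pdivrMr ?mul1r; lra.
pose Z := \sum_t p t * expR (s * f t).
have ZE : Z <= 1 + s ^+ 2 * (2 * \sum_t p t * f t ^+ 2).
  have -> : 1 + s ^+ 2 * (2 * \sum_t p t * f t ^+ 2) =
      \sum_t p t * (1 + s * f t + 2 * (s * f t) ^+ 2).
    have -> : \sum_t p t * (1 + s * f t + 2 * (s * f t) ^+ 2) =
       \sum_t (p t + s * (p t * f t) + (s ^+ 2 * 2) * (p t * f t ^+ 2)).
      by apply: eq_bigr => t _; ring.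
    by rewrite !big_split /= -!mulr_sumr p1 pf0 mulr0 addr0 mulrA.
  by apply: ler_sum => t _; rewrite ler_pM2l // expR_le_quadratic.
have Z0 : 0 < Z.
  (* On an empty [T] the probabilities could not sum to 1. *)
  case: (pickP (fun t : T => true)) => [t _|T0].
    rewrite /Z (bigD1 t) //=; apply: ltr_wpDr; last by rewrite mulr_gt0 ?expR_gt0.
    by apply: sumr_ge0 => u _; rewrite mulr_ge0 ?expR_ge0 // ltW.
  by move: p1; rewrite big_pred0 // => /eqP; rewrite eq_sym oner_eq0.
pose q : {ffun T -> R} := [ffun t => p t * expR (s * f t) / Z].
have lnq t : ln (q t) = ln (p t) + s * f t - ln Z.
  by rewrite ffunE ln_div ?lnM ?expRK ?posrE ?mulr_gt0 ?expR_gt0.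
have qL : log_affine L q.
  split=> [t||].
  - by rewrite ffunE divr_gt0 ?mulr_gt0 ?expR_gt0.
  - under eq_bigr do rewrite ffunE.
    by rewrite -mulr_suml divff // gt_eqF.
  - have -> : ([ffun t => ln (q t)] : fspace R T) =
      ([ffun t => ln (p t)] : fspace R T) + s *: (f : fspace R T) -
        ([ffun=> ln Z] : fspace R T).
      by apply/ffunP=> t; rewrite [LHS]ffunE lnq !ffunE.
    by apply: memvB (const_memv _ L1); apply: memvD pL _; apply: memvZ.
have := pmax _ qL; rewrite /loglik.
under eq_bigr do rewrite lnq mulrBr mulrDr.
rewrite sumrB big_split /= -mulr_suml -nE.
have -> : \sum_t (x t)%:R * (s * f t) = s * \sum_t (x t)%:R * f t.
  by rewrite mulr_sumr; apply: eq_bigr => t _; ring.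
have lnZ := le_trans (ln_le_subr1 Z0) (lerB ZE (lexx 1)).
have := ler_wpM2l n0 lnZ.
set u := \sum_t _; set v := \sum_t _; set w := n * ln Z.
move=> h1 h2; apply: (@le_trans _ _ w); first by lra.
by apply: (le_trans h1); rewrite le_eqVlt; apply/orP; left; apply/eqP; ring.
Qed.

(** The score equations for [ln p - ln q], which lies in [L], turn the difference into [n] times the
    Kullback-Leibler divergence of [p] from [q]. Adding [q - p], whose sum is 0, makes every term
    nonnegative. *)
Lemma gibbs_score (R : realType) (T : finType) (L : {vspace fspace R T})
    (x : {ffun T -> nat}) (p q : {ffun T -> R}) :
  score_equations L x p -> log_affine L p -> log_affine L q ->
  loglik x p - loglik x q =
    (\sum_t x t)%:R * \sum_t p t * (q t / p t - 1 - ln (q t / p t)).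
Proof.
move=> Sp [p0 p1 pL] [q0 q1 qL].
have dE t : (([ffun t => ln (p t)] : fspace R T) -
    ([ffun t => ln (q t)] : fspace R T)) t = ln (p t) - ln (q t).
  by rewrite !ffunE.
have := Sp _ (memvB pL qL).
rewrite (eq_bigr _ (fun t _ => congr1 (fun u => (x t)%:R * u) (dE t))).
rewrite (eq_bigr _ (fun t _ => congr1 (fun u => p t * u) (dE t))).
rewrite (eq_bigr _ (fun t _ => mulrBr (x t)%:R _ _)) sumrB /loglik => ->.
congr (_ * _).
have -> : \sum_t p t * (q t / p t - 1 - ln (q t / p t)) =
    \sum_t (q t - p t + p t * (ln (p t) - ln (q t))).
  apply: eq_bigr => t _; rewrite ln_div ?posrE //.
  by have := p0 t; move: (ln _) (ln _) => a b pt; field; rewrite gt_eqF.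
by rewrite big_split /= sumrB p1 q1 subrr add0r.
Qed.

Lemma gibbs_term_ge0 (R : realType) (T : finType) (p q : {ffun T -> R}) (t : T) :
  (forall t, 0 < p t) -> (forall t, 0 < q t) ->
  0 <= p t * (q t / p t - 1 - ln (q t / p t)).
Proof.
move=> p0 q0; apply: mulr_ge0; [exact: ltW | rewrite subr_ge0].
by apply: ln_le_subr1; rewrite divr_gt0.
Qed.

Lemma score_MLE (R : realType) (T : finType) (L : {vspace fspace R T})
    (x : {ffun T -> nat}) (p : {ffun T -> R}) :
  log_affine L p -> score_equations L x p -> is_MLE L x p.
Proof.
move=> pL Sp; split=> // q qL.
rewrite -subr_ge0 (gibbs_score Sp pL qL) mulr_ge0 // sumr_ge0 // => t _.
by case: pL qL => p0 _ _ [q0 _ _]; apply: gibbs_term_ge0.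
Qed.

(** Since [n > 0], the divergence from [gibbs_score] has to vanish, hence each of its terms does,
    and the equality case of [ln y <= y - 1] gives [q t / p t = 1]. *)
Lemma MLE_unique (R : realType) (T : finType) (L : {vspace fspace R T})
    (x : {ffun T -> nat}) (p q : {ffun T -> R}) :
  (0 < \sum_t x t)%N -> log_affine L p -> score_equations L x p ->
  is_MLE L x q -> q = p.
Proof.
move=> n0 pL Sp [qL qmax].
case: (pL) (qL) => p0 _ _ [q0 _ _].
have g0 t := gibbs_term_ge0 t p0 q0.
have : loglik x p - loglik x q <= 0 by rewrite subr_le0 qmax.
rewrite (gibbs_score Sp pL qL) pmulr_rle0 ?ltr0n // => s0.
have s1 : \sum_t p t * (q t / p t - 1 - ln (q t / p t)) = 0.
  by apply/eqP; rewrite eq_le s0 sumr_ge0.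
apply/ffunP=> t.
have /eqP : p t * (q t / p t - 1 - ln (q t / p t)) = 0.
  exact: (psumr_eq0P (fun t _ => g0 t) s1).
rewrite mulf_eq0 gt_eqF //= subr_eq0 => /eqP E.
have := ln_eq_subr1 _ (esym E); rewrite divr_gt0 // => /(_ isT) E1.
by rewrite -[q t](@divfK _ (p t)) ?E1 ?mul1r // gt_eqF.
Qed.

(** * Fibres of the restriction maps and sums over them *)

Lemma restr_eqP (m : nat) (lev : 'I_m -> nat) (D : {set 'I_m}) (i i' : cell lev) :
  reflect (forall j, j \in D -> i j = i' j) (restr D i == restr D i').
Proof.
apply: (iffP eqP) => [E j jD|E].
  by move/ffunP: E => /(_ (exist _ j jD)); rewrite !ffunE.
by apply/ffunP=> j; rewrite !ffunE; apply: E; apply: (valP j).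
Qed.

Lemma restrS (m : nat) (lev : 'I_m -> nat) (D E : {set 'I_m}) (i i' : cell lev) :
  D \subset E -> restr E i = restr E i' -> restr D i = restr D i'.
Proof.
move=> sDE /eqP/restr_eqP eE; apply/eqP/restr_eqP=> j jD.
exact/eE/(subsetP sDE).
Qed.

Lemma restrT_inj (m : nat) (lev : 'I_m -> nat) : injective (@restr m lev setT).
Proof. by move=> i i' /eqP/restr_eqP E; apply/ffunP=> j; apply: E. Qed.

Definition glue (m : nat) (lev : 'I_m -> nat) (A : {set 'I_m}) (i i' : cell lev) :
    cell lev :=
  [ffun j => if j \in A then i j else i' j].

(** Prescriptions on [A] and on [B] that are compatible on the overlap amount to a single one on the
    union, so the cells satisfying both form one fibre, whose size is known. *)
Lemma glue_restr (m : nat) (lev : 'I_m -> nat) (A B : {set 'I_m})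
    (i i' k : cell lev) :
  restr (A :&: B) i = restr (A :&: B) i' ->
  (restr A k == restr A i) && (restr B k == restr B i') =
  (restr (A :|: B) k == restr (A :|: B) (glue A i i')).
Proof.
move=> /eqP/restr_eqP eAB.
apply/andP/restr_eqP => [[/restr_eqP kA /restr_eqP kB] j|k_glue].
  rewrite inE ffunE; case: ifP => [jA _|_ /= jB]; [exact: kA | exact: kB].
split; apply/restr_eqP=> j jD; rewrite k_glue ?inE ?jD ?orbT // ffunE ?jD //.
by case: ifP => // jA; apply: eAB; rewrite inE jA jD.
Qed.

Definition depends (T : Type) (m : nat) (lev : 'I_m -> nat) (D : {set 'I_m})
    (f : cell lev -> T) : Prop :=
  forall i i' : cell lev, restr D i = restr D i' -> f i = f i'.

(** [marginal D f] pulled back to the full table. *)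
Definition msum (R : nmodType) (m : nat) (lev : 'I_m -> nat) (D : {set 'I_m})
    (f : cell lev -> R) (i : cell lev) : R :=
  \sum_(k : cell lev | restr D k == restr D i) f k.

(** The common size of all fibres of [restr D], in the [foldr] shape that [card_family] produces. *)
Definition fiber_card (m : nat) (lev : 'I_m -> nat) (D : {set 'I_m}) : nat :=
  foldr muln 1%N [seq if j \in D then 1%N else lev j | j : 'I_m].

Lemma card_fiber (m : nat) (lev : 'I_m -> nat) (D : {set 'I_m}) (i : cell lev) :
  #|[pred k : cell lev | restr D k == restr D i]| = fiber_card lev D.
Proof.
pose F (j : 'I_m) : pred 'I_(lev j) := fun a => (j \in D) ==> (a == i j).
have -> : #|[pred k : cell lev | restr D k == restr D i]| =
          #|(family F : simpl_pred (cell lev))|.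
  apply: eq_card => k; rewrite !inE.
  apply/restr_eqP/familyP => H j; first by apply/implyP=> /H ->.
  by move=> jD; have := H j; rewrite unfold_in /F jD => /eqP.
rewrite card_family; congr foldr; apply: eq_map => j.
case: ifP => jD.
  rewrite -(card1 (i j)); apply: eq_card => a.
  by rewrite !inE /F jD.
by rewrite -[RHS]card_ord; apply: eq_card => a; rewrite !inE /F jD.
Qed.

Lemma msum_depends (R : nmodType) (m : nat) (lev : 'I_m -> nat) (D : {set 'I_m})
    (f : cell lev -> R) : depends D (msum D f).
Proof. by move=> i i' e; rewrite /msum e. Qed.

Lemma msumT (R : nmodType) (m : nat) (lev : 'I_m -> nat) (f : cell lev -> R)
  (i : cell lev) : msum setT f i = f i.
Proof.
rewrite /msum (big_pred1 i) // => k.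
by apply/eqP/eqP => [/restrT_inj|->].
Qed.

Lemma msum0 (R : nmodType) (m : nat) (lev : 'I_m -> nat) (f : cell lev -> R)
  (i : cell lev) : msum set0 f i = \sum_k f k.
Proof. by apply: eq_bigl => k; apply/restr_eqP => j; rewrite inE. Qed.

Lemma eq_msum (R : nmodType) (m : nat) (lev : 'I_m -> nat) (D : {set 'I_m})
    (f g : cell lev -> R) : f =1 g -> msum D f =1 msum D g.
Proof. by move=> fg i; apply: eq_bigr. Qed.

Lemma msum_fiber (R : pzRingType) (m : nat) (lev : 'I_m -> nat) (D : {set 'I_m})
    (f : cell lev -> R) (i : cell lev) :
  depends D f -> msum D f i = (fiber_card lev D)%:R * f i.
Proof.
move=> fD; rewrite /msum (eq_bigr (fun _ => f i)); last by move=> k /eqP /fD.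
by rewrite sumr_const -(card_fiber D i) mulr_natl.
Qed.

Lemma msum_mull (R : pzRingType) (m : nat) (lev : 'I_m -> nat) (D : {set 'I_m})
    (f g : cell lev -> R) (i : cell lev) :
  depends D f -> msum D (fun k => f k * g k) i = f i * msum D g i.
Proof. by move=> fD; rewrite /msum mulr_sumr; apply: eq_bigr => k /eqP /fD ->. Qed.

(** After exchanging the sums, [f l] is counted once for each [k] that agrees with [i] on [A] and
    with [l] on [B]. Such [k] exist only if [i] and [l] agree on [A :&: B], and then they form a
    fibre over [A :|: B]. *)
Lemma msum_msum (R : pzRingType) (m : nat) (lev : 'I_m -> nat) (A B : {set 'I_m})
    (f : cell lev -> R) (i : cell lev) :
  msum A (msum B f) i = (fiber_card lev (A :|: B))%:R * msum (A :&: B) f i.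
Proof.
rewrite /msum (exchange_big_dep (fun k => restr (A :&: B) k == restr (A :&: B) i)) /=;
  last first.
  move=> k l /eqP kA /eqP lB; apply/eqP.
  rewrite (restrS (subsetIr A B) lB).
  exact: (restrS (subsetIl A B) kA).
rewrite mulr_sumr; apply: eq_bigr => l /eqP lAB.
rewrite sumr_const -[LHS]mulr_natl -(card_fiber _ (glue A i l)); congr (_%:R * _).
apply: eq_card => k; rewrite !inE -(glue_restr k (esym lAB)).
by rewrite unfold_in [restr B l == _]eq_sym.
Qed.

Lemma fiber_card_gt0 (m : nat) (lev : 'I_m -> nat) (D : {set 'I_m}) :
  (forall j, (0 < lev j)%N) -> (0 < fiber_card lev D)%N.
Proof.
move=> lev0; rewrite /fiber_card /image_mem; elim: (enum _) => /= [|j s IH] //.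
by rewrite muln_gt0 IH andbT; case: ifP.
Qed.

Lemma msum_gt0 (R : numDomainType) (m : nat) (lev : 'I_m -> nat) (D : {set 'I_m})
    (f : cell lev -> R) (i : cell lev) :
  (forall k, 0 < f k) -> 0 < msum D f i.
Proof.
move=> f0; rewrite /msum (bigD1 i) //=; apply: ltr_wpDr => //.
by apply: sumr_ge0 => k _; apply: ltW.
Qed.

Lemma lev_gt0_of_cell (m : nat) (lev : 'I_m -> nat) (i : cell lev) (j : 'I_m) :
  (0 < lev j)%N.
Proof. exact: leq_ltn_trans (ltn_ord (i j)). Qed.

(** * Marginals of a function that factorizes over two vertex sets *)

(** Sum the factorization over the fibres over [A]: [g] comes out, and [h], being [msum C h] up to a
    constant, is reduced by [msum_msum] to a sum over [A :&: C]. The fibre sizes appear because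
    every marginal is kept as a function on the full table. *)
Lemma msum_factorl (R : fieldType) (m : nat) (lev : 'I_m -> nat) (A C : {set 'I_m})
    (p g h : cell lev -> R) (i : cell lev) :
  (fiber_card lev (A :|: C))%:R != 0 :> R ->
  depends A g -> depends C h ->
  (forall k, msum (A :|: C) p k = g k * h k) ->
  (fiber_card lev C)%:R * msum A p i = g i * msum (A :&: C) h i.
Proof.
move=> N0 gA hC pE.
apply: (mulfI N0).
have E1 : (fiber_card lev (A :|: C))%:R * msum A p i = g i * msum A h i.
  rewrite -msum_mull // -(eq_msum _ pE) msum_msum.
  by rewrite setUA setUid (setIidPl (subsetUl _ _)).
have E2 : (fiber_card lev C)%:R * msum A h i =
    (fiber_card lev (A :|: C))%:R * msum (A :&: C) h i.
  rewrite -msum_msum (eq_msum _ (fun k => msum_fiber k hC)).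
  by rewrite /msum mulr_sumr.
by rewrite mulrCA E1 mulrCA E2 mulrCA.
Qed.

Lemma msum_factorr (R : fieldType) (m : nat) (lev : 'I_m -> nat) (A C : {set 'I_m})
    (p g h : cell lev -> R) (i : cell lev) :
  (fiber_card lev (A :|: C))%:R != 0 :> R ->
  depends A g -> depends C h ->
  (forall k, msum (A :|: C) p k = g k * h k) ->
  (fiber_card lev A)%:R * msum C p i = h i * msum (A :&: C) g i.
Proof.
move=> N0 gA hC pE; rewrite setIC; apply: msum_factorl => //.
  by rewrite setUC.
by move=> k; rewrite setUC pE mulrC.
Qed.

(** Multiply the formulas for the marginals on [A] and [C]. The product [g * h] is the marginal on
    [A :|: C]; summing the formula for [A] over the fibres over [A :&: C] identifies the remaining
    product with the marginal there ([ES]). *)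
Lemma msum_markov (R : numFieldType) (m : nat) (lev : 'I_m -> nat) (A C : {set 'I_m})
    (p g h : cell lev -> R) (i : cell lev) :
  depends A g -> depends C h ->
  (forall k, msum (A :|: C) p k = g k * h k) ->
  msum (A :|: C) p i * msum (A :&: C) p i = msum A p i * msum C p i.
Proof.
move=> gA hC pE.
have N0 D : (fiber_card lev D)%:R != 0 :> R.
  by rewrite pnatr_eq0 -lt0n fiber_card_gt0 // => j; apply: lev_gt0_of_cell i j.
have EA k := msum_factorl k (N0 (A :|: C)) gA hC pE.
have EC := msum_factorr i (N0 (A :|: C)) gA hC pE.
have ES : (fiber_card lev C)%:R * ((fiber_card lev A)%:R * msum (A :&: C) p i) =
    msum (A :&: C) h i * msum (A :&: C) g i.
  have -> : (fiber_card lev A)%:R * msum (A :&: C) p i =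
      msum (A :&: C) (msum A p) i.
    rewrite msum_msum [A :&: C :&: A]setIAC setIid.
    by rewrite (setUidPr (subsetIl _ _)).
  rewrite -msum_mull; last exact: msum_depends.
  rewrite [LHS]mulr_sumr; apply: eq_bigr => k _.
  by rewrite EA mulrC.
apply: (mulfI (N0 A)); apply: (mulfI (N0 C)).
rewrite pE.
transitivity (g i * h i * (msum (A :&: C) h i * msum (A :&: C) g i)).
  by rewrite -ES; ring.
transitivity ((g i * msum (A :&: C) h i) * (h i * msum (A :&: C) g i)); first by ring.
by rewrite -EA -EC; ring.
Qed.

(** * Log-marginals in [L] and the recursion over the components *)

Lemma Fsub_depends (R : realType) (m : nat) (lev : 'I_m -> nat) (D : {set 'I_m})
    (f : fspace R (cell lev)) : f \in Fsub R lev D <-> depends D f.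
Proof.
split=> [/Fsub_P fD i i' /eqP/restr_eqP | fD]; first exact: fD.
by apply/Fsub_P => i i' e; apply: fD; apply/eqP/restr_eqP.
Qed.

Lemma FsubS (R : realType) (m : nat) (lev : 'I_m -> nat) (D E : {set 'I_m}) :
  D \subset E -> (Fsub R lev D <= Fsub R lev E)%VS.
Proof.
move=> sDE; apply/subvP => f /Fsub_depends fD; apply/Fsub_depends => i i'.
by move/(restrS sDE); apply: fD.
Qed.

Lemma subv_sum_seq (K : fieldType) (vT : vectType K) (I : eqType) (s : seq I)
    (V : I -> {vspace vT}) (k : I) :
  k \in s -> (V k <= \sum_(l <- s) V l)%VS.
Proof. by move=> ks; rewrite (big_rem k) //= addvSl. Qed.

Lemma conformal_sum_depends (R : realType) (m : nat) (lev : 'I_m -> nat)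
    (L : {vspace fspace R (cell lev)}) (s : seq {set 'I_m}) :
  (\sum_(C <- s) (L :&: Fsub R lev C) <= Fsub R lev (\bigcup_(C <- s) C))%VS.
Proof.
elim: s => [|C s IH]; first by rewrite !big_nil sub0v.
rewrite !big_cons subv_add; apply/andP; split.
  by apply: (subv_trans (capvSr _ _)); apply/FsubS/subsetUl.
by apply: (subv_trans IH); apply/FsubS/subsetUr.
Qed.

Definition lnf (R : realType) (T : finType) (f : T -> R) : fspace R T :=
  [ffun t => ln (f t)].

Lemma lnf_Fsub (R : realType) (m : nat) (lev : 'I_m -> nat) (D : {set 'I_m})
    (f : cell lev -> R) : depends D f -> lnf f \in Fsub R lev D.
Proof. by move=> fD; apply/Fsub_depends => i i' /fD e; rewrite !ffunE e. Qed.

Lemma sep_at_rcons (m : nat) (s : seq {set 'I_m}) (C : {set 'I_m}) (k : nat) :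
  (k < size s)%N -> sep_at (rcons s C) k = sep_at s k.
Proof.
by move=> ks; rewrite /sep_at nth_rcons ks -cats1 takel_cat // ltnW.
Qed.

Lemma sep_at_last (m : nat) (s : seq {set 'I_m}) (C : {set 'I_m}) :
  sep_at (rcons s C) (size s) = (\bigcup_(D <- s) D) :&: C.
Proof. by rewrite /sep_at nth_rcons ltnn eqxx -cats1 take_size_cat. Qed.

(** The hypothesis concerns the marginal on the union of [s], so that it is inherited when the last
    component is removed. The product of separators starts at position 0, where the empty separator
    contributes the total mass 1. *)
Lemma junction_tree (R : realType) (m : nat) (lev : 'I_m -> nat)
    (L : {vspace fspace R (cell lev)}) (p : cell lev -> R) (s : seq {set 'I_m}) :
  (forall i, 0 < p i) -> \sum_i p i = 1 ->
  (forall k, (k < size s)%N -> saturated L (sep_at s k)) ->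
  (forall k, (0 < k < size s)%N ->
     exists2 C, C \in take k s & sep_at s k \subset C) ->
  lnf (msum (\bigcup_(C <- s) C) p) \in (\sum_(C <- s) (L :&: Fsub R lev C))%VS ->
  (forall i, msum (\bigcup_(C <- s) C) p i * \prod_(k < size s) msum (sep_at s k) p i
             = \prod_(C <- s) msum C p i) /\
  (forall C, C \in s -> lnf (msum C p) \in L).
Proof.
move=> p0 p1; elim/last_ind: s => [|s C IH] Lsep running lnp.
  by split=> // i; rewrite !big_nil big_ord0 msum0 p1 mulr1.
have N0 D : cell lev -> 0 < (fiber_card lev D)%:R :> R.
  by move=> i; rewrite ltr0n fiber_card_gt0 // => j; apply: lev_gt0_of_cell i j.
set A := \bigcup_(D <- s) D.
have UE : \bigcup_(D <- rcons s C) D = A :|: C by rewrite big_rcons.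
rewrite UE in lnp *.
move: lnp; rewrite big_rcons /= => /memv_addP[u us [v]].
rewrite memv_cap => /andP[vL vC] uvE.
pose g i := expR (u i); pose h i := expR (v i).
have gA : depends A g.
  move=> i i' e; rewrite /g; congr expR.
  by have /Fsub_depends := subvP (conformal_sum_depends _ _) _ us; apply.
have hC : depends C h.
  by move=> i i' e; rewrite /h; congr expR; move/Fsub_depends: vC; apply.
have ghE k : msum (A :|: C) p k = g k * h k.
  have := congr1 (fun f : fspace R (cell lev) => f k) uvE.
  rewrite !ffunE -expRD => <-.
  by rewrite lnK // posrE msum_gt0.
have LS : saturated L (A :&: C).
  by have := Lsep (size s); rewrite sep_at_last size_rcons ltnSn; apply.
(* The correction to [u] depends only on [A :&: C], so saturation puts it in [L]; likewise for [v]
   in [lnC]. *)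
have lnA : lnf (msum A p) = u + lnf (fun i => msum (A :&: C) h i / (fiber_card lev C)%:R).
  apply/ffunP=> i; rewrite !ffunE -[u i]expRK -/(g i) -lnM ?posrE ?expR_gt0 //;
    last by rewrite divr_gt0 ?N0 // msum_gt0 // => k; apply: expR_gt0.
  congr ln; apply: (mulfI (lt0r_neq0 (N0 C i))).
  rewrite (msum_factorl i _ gA hC ghE) ?lt0r_neq0 ?N0 //.
  by field; rewrite lt0r_neq0 ?N0.
have lnC : lnf (msum C p) = v + lnf (fun i => msum (A :&: C) g i / (fiber_card lev A)%:R).
  apply/ffunP=> i; rewrite !ffunE -[v i]expRK -/(h i) -lnM ?posrE ?expR_gt0 //;
    last by rewrite divr_gt0 ?N0 // msum_gt0 // => k; apply: expR_gt0.
  congr ln; apply: (mulfI (lt0r_neq0 (N0 A i))).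
  rewrite (msum_factorr i _ gA hC ghE) ?lt0r_neq0 ?N0 //.
  by field; rewrite lt0r_neq0 ?N0.
have depS (f : cell lev -> R) (c : R) : depends (A :&: C) (fun i => msum (A :&: C) f i / c).
  by move=> i i' /msum_depends ->.
have lnA_sum : lnf (msum A p) \in (\sum_(D <- s) (L :&: Fsub R lev D))%VS.
  (* With no component left, the marginal is the total mass 1, and its logarithm 0 lies in the empty
     sum of subspaces. *)
  have [s0|s_gt0] := posnP (size s).
    move: s0; rewrite /A => /size0nil ->; rewrite !big_nil memv0.
    by apply/eqP/ffunP=> i; rewrite !ffunE msum0 p1 ln1.
  (* Running intersection: the separator lies inside a single earlier component [D], so the
     correction is absorbed by the summand of [D] and the form stays conformal. *)
  have [|D] := running (size s); first by rewrite s_gt0 size_rcons ltnSn.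
  rewrite sep_at_last -cats1 take_size_cat // => Ds sSD.
  rewrite lnA; apply: memvD us _.
  apply: (subvP (subv_sum_seq _ Ds)); rewrite memv_cap.
  have wS := lnf_Fsub (depS h (fiber_card lev C)%:R).
  by rewrite (subvP LS) //= (subvP (FsubS _ _ sSD)).
have [||prodE lnL] := IH _ _ lnA_sum.
- move=> k ks; rewrite -(sep_at_rcons C ks); apply: Lsep.
  by rewrite size_rcons ltnS ltnW.
- move=> k /andP[k0 ks]; have := running k; rewrite k0 size_rcons ltnS ltnW //.
  by rewrite sep_at_rcons // -cats1 takel_cat ?(ltnW ks) //; apply.
split=> [i|D].
  rewrite size_rcons big_ord_recr /= sep_at_last big_rcons /= -prodE -/A.
  rewrite (eq_bigr (fun k : 'I_(size s) => msum (sep_at s k) p i)); last first.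
    by move=> k _; rewrite sep_at_rcons.
  by rewrite mulrCA (msum_markov i gA hC ghE); ring.
rewrite mem_rcons inE => /predU1P[-> | /lnL //].
rewrite lnC; apply: memvD vL _.
exact: (subvP LS _ (lnf_Fsub (depS _ _))).
Qed.

(** A singleton is a compact component, since separating [j] from itself would put it in two
    disjoint blocks; it extends to a maximal one. *)
Lemma max_compact_components_cover (m : nat) (H : {set {set 'I_m}}) (j : 'I_m) :
  exists2 C, C \in max_compact_components H & j \in C.
Proof.
have cj : compact_component H [set j].
  apply/'forall_in_forall_inP => u /set1P-> v /set1P->.
  apply/forall_inP => S _; apply/negP => /andP[_].
  move=> /existsP[A /existsP[B /and3P[/and5P[_ dAB _ _ _] jA jB]]].
  by move/pred0P: dAB => /(_ j) /=; rewrite jA jB.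
have [C Cmax jC] := maxset_exists cj.
by exists C; rewrite ?inE // -sub1set.
Qed.

(** * Transfer to the marginal tables *)

Lemma marginalE (R : nmodType) (m : nat) (lev : 'I_m -> nat) (D : {set 'I_m})
    (f : {ffun cell lev -> R}) (i : cell lev) :
  marginal D f (restr D i) = msum D f i.
Proof. by rewrite ffunE. Qed.

Lemma sum_marginal_mull (R : pzRingType) (m : nat) (lev : 'I_m -> nat)
    (D : {set 'I_m}) (f : {ffun cell lev -> R}) (g : mcell lev D -> R) :
  \sum_y marginal D f y * g y = \sum_i f i * g (restr D i).
Proof.
rewrite (partition_big (restr D) predT) //=.
apply: eq_bigr => y _; rewrite ffunE mulr_suml.
by apply: eq_bigr => i /eqP ->.
Qed.

Lemma sum_marginal (R : nmodType) (m : nat) (lev : 'I_m -> nat)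
    (D : {set 'I_m}) (f : {ffun cell lev -> R}) :
  \sum_y marginal D f y = \sum_i f i.
Proof.
rewrite [RHS](partition_big (restr D) predT) //=.
by apply: eq_bigr => y _; rewrite ffunE.
Qed.

Lemma marginal_natr (R : pzSemiRingType) (m : nat) (lev : 'I_m -> nat)
    (D : {set 'I_m}) (x : {ffun cell lev -> nat}) (y : mcell lev D) :
  (marginal D x y)%:R = marginal D [ffun i => (x i)%:R : R] y.
Proof. by rewrite !ffunE natr_sum; apply: eq_bigr => i _; rewrite ffunE. Qed.

Lemma restr_surj (m : nat) (lev : 'I_m -> nat) (D : {set 'I_m}) (i0 : cell lev)
    (y : mcell lev D) : exists i : cell lev, restr D i = y.
Proof.
(* Off [D] the cell [i0] supplies the levels. On [D] the level [y k] is cast along [val k = j]; at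
   [j = val k] the cast is trivial by [eq_axiomK]. *)
pose i : cell lev := [ffun j =>
  if insub j is Some k then
     (if eqP : reflect _ (val (k : {j : 'I_m | j \in D}) == j) is ReflectT e then
        ecast z 'I_(lev z) e (y k) else i0 j)
  else i0 j].
exists i; apply/ffunP=> k; rewrite !ffunE valK.
by case: eqP => // e; rewrite eq_axiomK.
Qed.

Lemma pullbackE (R : realType) (m : nat) (lev : 'I_m -> nat) (D : {set 'I_m})
    (g : fspace R (mcell lev D)) (i : cell lev) :
  linfun (@pullback R m lev D) g i = g (restr D i).
Proof. by rewrite lfunE ffunE. Qed.

(** Saturation puts the indicator of each marginal cell, pulled back, into [L]; its score equation
    is the claim. *)
Lemma score_saturated (R : realType) (m : nat) (lev : 'I_m -> nat)
    (L : {vspace fspace R (cell lev)}) (x : {ffun cell lev -> nat})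
    (p : {ffun cell lev -> R}) (S : {set 'I_m}) (y : mcell lev S) :
  score_equations L x p -> saturated L S ->
  (marginal S x y)%:R = (\sum_i x i)%:R * marginal S p y.
Proof.
move=> Sp LS; pose d : fspace R (mcell lev S) := [ffun z => (z == y)%:R].
have dL : linfun (@pullback R m lev S) d \in L.
  by apply: (subvP LS); apply/memv_img/memvf.
have mE (f : {ffun cell lev -> R}) :
    \sum_i f i * linfun (@pullback R m lev S) d i = marginal S f y.
  rewrite ffunE [RHS]big_mkcond; apply: eq_bigr => i _.
  by rewrite pullbackE ffunE; case: ifP => _; rewrite ?mulr1 ?mulr0.
rewrite marginal_natr -!mE -(Sp _ dL).
by apply: eq_bigr => i _; rewrite ffunE.
Qed.

(** Test functions of the marginal model pull back into [L], and summing over fibres identifies both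
    sides with those of the full score equation. *)
Lemma score_marginal (R : realType) (m : nat) (lev : 'I_m -> nat)
    (L : {vspace fspace R (cell lev)}) (x : {ffun cell lev -> nat})
    (p : {ffun cell lev -> R}) (C : {set 'I_m}) :
  score_equations L x p ->
  score_equations (marginal_space L C) (marginal C x) (marginal C p).
Proof.
move=> Sp f; rewrite -memv_preim memv_cap => /andP[fL _].
have := Sp _ fL; rewrite sum_marginal_mull sum_marginal.
under [\sum_i (x i)%:R * _]eq_bigr do rewrite pullbackE.
under [\sum_i p i * _]eq_bigr do rewrite pullbackE.
move=> <-.
rewrite (eq_bigr (fun y => marginal C [ffun i => (x i)%:R : R] y * f y)).
  by rewrite sum_marginal_mull; apply: eq_bigr => i _; rewrite ffunE.
by move=> y _; congr (_ * _); apply: marginal_natr.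
Qed.

(** The cell [i0] makes every marginal cell a restriction, whence positivity on the marginal
    table. *)
Lemma log_affine_marginal (R : realType) (m : nat) (lev : 'I_m -> nat)
    (L : {vspace fspace R (cell lev)}) (p : {ffun cell lev -> R})
    (C : {set 'I_m}) (i0 : cell lev) :
  log_affine L p -> lnf (msum C p) \in L ->
  log_affine (marginal_space L C) (marginal C p).
Proof.
move=> [p0 p1 pL] lnC; split=> [y||].
- by have [i <-] := restr_surj i0 y; rewrite marginalE msum_gt0.
- by rewrite sum_marginal.
- rewrite -memv_preim.
  suff -> : linfun (@pullback R m lev C) [ffun y => ln (marginal C p y)] =
     lnf (msum C p).
    by rewrite memv_cap lnC lnf_Fsub //; apply: msum_depends.
  by apply/ffunP=> i; rewrite pullbackE !ffunE.
Qed.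

(** * The product formula and the MLEs of the marginal models *)

Theorem theorem1 (R : realType) (m : nat) (lev : 'I_m -> nat)
    (lev_ge2 : forall j, (2 <= lev j)%N)
    (Delta : {set {set 'I_m}}) (Delta_complex : simplicial_complex Delta)
    (Cs : seq {set 'I_m}) (Cs_perfect : perfect_ordering (red Delta) Cs)
    (L : {vspace fspace R (cell lev)})
    (L_const : ([ffun=> 1] : fspace R (cell lev)) \in L)
    (L_HSM : HSM Delta Cs L)
    (x : {ffun cell lev -> nat}) (n : nat)
    (n_total : n = (\sum_(i : cell lev) x i)%N) (n_gt0 : (0 < n)%N)
    (p : {ffun cell lev -> R}) (p_MLE : is_MLE L x p) :
  (forall i : cell lev,
     p i = (\prod_(C in max_compact_components (red Delta))
              marginal C p (restr C i))
           / (\prod_(S <- divider_seq Cs) marginal S p (restr S i))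
     /\
     p i = (\prod_(C in max_compact_components (red Delta))
              marginal C p (restr C i))
           / (\prod_(S <- divider_seq Cs)
                ((marginal S x (restr S i))%:R / n%:R)))
  /\
  (forall C, C \in max_compact_components (red Delta) ->
     forall q : {ffun mcell lev C -> R},
       is_MLE (marginal_space L C) (marginal C x) q <-> q = marginal C p).
Proof.
case: Cs_perfect => Cs_uniq Cs_mem _ running; case: L_HSM => L_sat L_conf.
have Sp := MLE_score L_const p_MLE.
case: (p_MLE) => pLA _; case: (pLA) => p0 p1 pL.
have cover : \bigcup_(C <- Cs) C = setT.
  apply/setP=> j; rewrite inE; have [C CM jC] := max_compact_components_cover (red Delta) j.
  by rewrite (big_rem C) ?Cs_mem //= inE jC.
have Cs_big (T : Type) (idx : T) (op : Monoid.com_law idx) (F : {set 'I_m} -> T) :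
    \big[op/idx]_(C in max_compact_components (red Delta)) F C =
    \big[op/idx]_(C <- Cs) F C.
  by rewrite big_uniq //; apply: eq_bigl => C; rewrite Cs_mem.
have sep0 : sep_at Cs 0 = set0 by rewrite /sep_at take0 big_nil set0I.
(* Position 0 is absent from [divider_seq]; its empty separator is saturated because [L] contains
   the constants. *)
have L_sep k : (k < size Cs)%N -> saturated L (sep_at Cs k).
  case: k => [_|k ks].
    rewrite sep0; apply/subvP => f /Fsub_depends f0.
    case: (pickP (fun i : cell lev => true)) => [i0 _|no_cell].
      have -> : f = [ffun=> f i0].
        apply/ffunP=> i; rewrite ffunE; apply: f0.
        by apply/eqP/restr_eqP => j; rewrite inE.
      exact: const_memv.
    suff -> : f = 0 by exact: mem0v.
    by apply/ffunP=> i; have := no_cell i.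
  apply: L_sat; apply/mapP; exists k.+1 => //.
  by rewrite mem_iota /= add1n prednK // (leq_trans _ ks).
have lnp : lnf (msum (\bigcup_(C <- Cs) C) p) \in (\sum_(C <- Cs) (L :&: Fsub R lev C))%VS.
  rewrite cover -Cs_big; suff -> : lnf (msum setT p) = [ffun i => ln (p i)].
    by move: pL; rewrite {1}L_conf.
  by apply/ffunP=> i; rewrite !ffunE msumT.
have [factor lnC] := junction_tree p0 p1 L_sep running lnp.
(* [divider_seq] starts at position 1; the extra factor at position 0 is 1. *)
have prod_sep i : \prod_(S <- divider_seq Cs) marginal S p (restr S i) =
    \prod_(k < size Cs) msum (sep_at Cs k) p i.
  rewrite big_map -(big_mkord predT (fun k => msum (sep_at Cs k) p i)) /index_iota subn0.
  case: (size Cs) => [|r]; first by rewrite /= !big_nil.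
  rewrite /= big_cons sep0 msum0 p1 mul1r.
  by apply: eq_bigr => k _; rewrite marginalE.
have formula i : p i = (\prod_(C in max_compact_components (red Delta))
              marginal C p (restr C i))
           / (\prod_(S <- divider_seq Cs) marginal S p (restr S i)).
  rewrite Cs_big prod_sep (eq_bigr _ (fun C _ => marginalE C p i)) -factor cover msumT.
  rewrite mulfK //; apply/prodf_neq0 => k _.
  by rewrite lt0r_neq0 // msum_gt0.
split=> [i|C CM q].
  split=> //; rewrite [LHS]formula; congr (_ / _).
  rewrite big_seq [RHS]big_seq; apply: eq_bigr => S SD.
  (* On a saturated divider the score equations give [x(i_S) = n * p(i_S)]. *)
  rewrite (score_saturated _ Sp (L_sat _ SD)) -n_total mulrAC divff ?mul1r //.
  by rewrite pnatr_eq0 -lt0n.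
have i0 : cell lev := [ffun j => Ordinal (ltnW (lev_ge2 j))].
have CLA : log_affine (marginal_space L C) (marginal C p).
  by apply: log_affine_marginal i0 pLA _; apply: lnC; rewrite Cs_mem.
have CS := score_marginal (C := C) Sp.
split=> [|->]; last exact: score_MLE.
by apply: MLE_unique => //; rewrite sum_marginal -n_total.
Qed.
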